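(* Let $n\ge 1$ be an integer and let $x_1^*,\dots,x_n^*\in B_{\ell_1(\Omega_0^n)}$. Then the dual of the space $W_{x_1^*,\dots,x_n^*}$ is isometric to $\ell_1$ (more precisely, to $\ell_1(\Omega_0^n)$), and the duality is given by the linear map $\phi:\ell_1(\Omega_0^n)\to W_{x_1^*,\dots,x_n^*}^*$ defined by $$\phi(z^* )(f)=\sum_{i=1}^n\left(\sum_{j=1}^\infty f\left(\tfrac1i,\tfrac1j\right)z^*(i,j)\right)$$ for every $z^*\in\ell_1(\Omega_0^n)$ and every $f\in W_{x_1^*,\dots,x_n^*}$; that is, $\phi$ is a linear isometry of $\ell_1(\Omega_0^n)$ onto $W_{x_1^*,\dots,x_n^*}^*$. Moreover, the $\sigma(\ell_1(\Omega_0^n),W_{x_1^*,\dots,x_n^*})$-limit points of the standard basis $\{e^*_{i,j}\}$ ($i=1,\dots,n$, $j=1,2,\dots$) of $\ell_1(\Omega_0^n)$ are $x_1^*,\dots,x_n^*$ and, for all $s=1,\dots,n$, the sequence $(e^*_{s,j})_{j\ge1}$ converges to $x_s^*$ in the topology $\sigma(\ell_1(\Omega_0^n),W_{x_1^*,\dots,x_n^*})$ as $j\to\infty$.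
   Context: All spaces are real. For an integer $n\ge1$ let $$\Omega_0^n=\left\{\left(\tfrac1i,\tfrac1j\right)\in\mathbb R^2: i=1,\dots,n,\ j=1,2,\dots\right\},\qquad \Omega^n=\Omega_0^n\cup\left\{\left(\tfrac1i,0\right)\in\mathbb R^2:i=1,\dots,n\right\},$$ with the Euclidean topology, so that $\Omega^n$ is compact. $C(\Omega^n)$ is the space of real-valued continuous functions on $\Omega^n$ with the supremum norm. $\ell_1(\Omega_0^n)$ is the space of absolutely summable families $z^*=(z^*(i,j))_{1\le i\le n,\,j\ge1}$ (the index $(i,j)$ corresponding to the point $(1/i,1/j)$) with norm $\|z^*\|=\sum_{i=1}^n\sum_{j=1}^\infty|z^*(i,j)|$; its standard basis vectors are denoted $e^*_{i,j}$, so $z^*=\sum_{i=1}^n\sum_{j=1}^\infty z^*(i,j)e^*_{i,j}$. $B_Y$ denotes the closed unit ball of a Banach space $Y$. For $x_1^*,\dots,x_n^*\in B_{\ell_1(\Omega_0^n)}$ define the closed subspace $$W_{x_1^*,\dots,x_n^*}=\left\{f\in C(\Omega^n): f\left(\tfrac1s,0\right)=\sum_{i=1}^n\left(\sum_{j=1}^\infty f\left(\tfrac1i,\tfrac1j\right)x_s^*(i,j)\right)\ \text{for all } s=1,\dots,n\right\}$$ of $C(\Omega^n)$. The topology $\sigma(\ell_1(\Omega_0^n),W_{x_1^*,\dots,x_n^*})$ is the weak$^*$ topology on $\ell_1(\Omega_0^n)$ obtained by identifying it with $W_{x_1^*,\dots,x_n^*}^*$ via $\phi$. *)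

(* Defs.v *)
From HB Require Import structures.
From mathcomp Require Import all_boot all_order all_algebra.
From mathcomp Require Import all_classical all_reals all_analysis.

Set Implicit Arguments.
Unset Strict Implicit.
Unset Printing Implicit Defensive.

Import Order.TTheory GRing.Theory Num.Theory.
Import numFieldNormedType.Exports.

Local Open Scope classical_set_scope.
Local Open Scope ring_scope.

Section sup_norm.
Variables (R : realType) (T : Type).
Implicit Types (A : set T) (f g : T -> R).

(* For empty A this is 0, since [sup set0 = 0]. *)
Definition sup_norm A f : R := sup [set `|f t| | t in A].

Definition bounded_on A f := exists M : R, forall t, A t -> `|f t| <= M.

Lemma le_sup_norm A f t : bounded_on A f -> A t -> `|f t| <= sup_norm A f.
Proof.
move=> [M fM] At; apply: ub_le_sup; last by exists t.
by exists M => _ [u Au <-]; exact: fM.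
Qed.

Lemma sup_norm_le A f M : 0 <= M -> (forall t, A t -> `|f t| <= M) ->
  sup_norm A f <= M.
Proof.
move=> M0 fM; have [->|/set0P [t At]] := eqVneq A set0.
  by rewrite /sup_norm image_set0 sup0.
apply: ge_sup; first by exists `|f t|, t.
by move=> _ [u Au <-]; exact: fM.
Qed.

Lemma sup_norm_ge0 A f : bounded_on A f -> 0 <= sup_norm A f.
Proof.
move=> fb; have [->|/set0P [t At]] := eqVneq A set0.
  by rewrite /sup_norm image_set0 sup0.
exact: le_trans (le_sup_norm fb At).
Qed.

Lemma sup_normD A f g : bounded_on A f -> bounded_on A g ->
  sup_norm A (f + g) <= sup_norm A f + sup_norm A g.
Proof.
move=> fb gb; apply: sup_norm_le; first by rewrite addr_ge0// sup_norm_ge0.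
move=> t At; rewrite (le_trans (ler_normD _ _))//.
by rewrite lerD// le_sup_norm.
Qed.

Lemma sup_normZ A f (l : R) : bounded_on A f ->
  sup_norm A (l *: f) = `|l| * sup_norm A f.
Proof.
move=> fb; have lfb : bounded_on A (l *: f).
  exists (`|l| * sup_norm A f) => t At.
  by rewrite normrM ler_wpM2l// le_sup_norm.
apply/eqP; rewrite eq_le; apply/andP; split.
  apply: sup_norm_le; first by rewrite mulr_ge0// sup_norm_ge0.
  by move=> t At; rewrite normrM ler_wpM2l// le_sup_norm.
have [->|l0] := eqVneq l 0.
  rewrite normr0 mul0r scale0r sup_norm_ge0//.
  by exists 0 => t _; rewrite normr0.
rewrite mulrC -ler_pdivlMr ?normr_gt0//; apply: sup_norm_le.
  by rewrite divr_ge0// sup_norm_ge0.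
move=> t At; rewrite ler_pdivlMr ?normr_gt0// mulrC -normrM.
exact: (le_sup_norm lfb At).
Qed.

End sup_norm.

Section dual.
Variables (R : realType) (V : normedModType R).

Definition dual_pred : {pred V -> R} :=
  [pred F : V -> R | `[< linear F /\ continuous F >]].

Lemma dual_submod_closed : submod_closed dual_pred.
Proof.
split.
  apply/asboolP; split; last exact: cst_continuous.
  by move=> a u v; rewrite /= scaler0 addr0.
move=> a F G /asboolP[linF cF] /asboolP[linG cG]; apply/asboolP; split.
  move=> b u v; rewrite !fctE/= linF linG.
  rewrite [a *: (_ + _)]scalerDr scalerDr !scalerA [b * a]mulrC.
  by rewrite addrACA.
move=> v; apply: (@continuousD _ _ _ (a *: F) G); last exact: cG.
exact: (@continuousZr _ _ _ F a v (cF v)).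
Qed.

HB.instance Definition _ :=
  GRing.isSubmodClosed.Build R (V -> R) dual_pred dual_submod_closed.

Record dual := Dual { dual_val :> V -> R ; _ : dual_val \in dual_pred }.

HB.instance Definition _ := [isSub for dual_val].
HB.instance Definition _ := [Choice of dual by <:].
HB.instance Definition _ := [SubChoice_isSubLmodule of dual by <:].

Definition unit_ball : set V := [set v | `|v| <= 1].

Lemma dual_linear (F : dual) : linear F.
Proof. by case: F => F /= /asboolP[]. Qed.

Lemma dual_continuous (F : dual) : continuous F.
Proof. by case: F => F /= /asboolP[]. Qed.

HB.instance Definition _ (F : dual) :=
  GRing.isLinear.Build R V R _ (dual_val F) (dual_linear F).

Lemma dual_bounded (F : dual) : bounded_on unit_ball F.
Proof.
have /linear_bounded_continuous/bounded_funP/(_ 1)[M FM] :=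
  @dual_continuous F.
by exists M.
Qed.

Definition dual_norm (F : dual) : R := sup_norm unit_ball F.

Lemma dual_normD (F G : dual) :
  dual_norm (F + G) <= dual_norm F + dual_norm G.
Proof. exact: (sup_normD (dual_bounded F) (dual_bounded G)). Qed.

Lemma dual_normZ (l : R) (F : dual) : dual_norm (l *: F) = `|l| * dual_norm F.
Proof. exact: (sup_normZ l (dual_bounded F)). Qed.

Lemma dual_norm0_eq0 (F : dual) : dual_norm F = 0 -> F = 0.
Proof.
move=> F0; apply/val_inj/funext => v /=.
have [->|v0] := eqVneq v 0; first by rewrite linear0.
have : `|F (`|v|^-1 *: v)| <= 0.
  rewrite -F0; apply: (le_sup_norm (dual_bounded F)).
  by rewrite /unit_ball/= normrZ normfV normr_id mulVf// normr_eq0.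
rewrite normr_le0 linearZ/= scaler_eq0 invr_eq0 normr_eq0 (negbTE v0)/=.
by move/eqP.
Qed.

HB.instance Definition _ :=
  Lmodule_isNormed.Build R dual dual_normD dual_normZ dual_norm0_eq0.

End dual.
Arguments dual {R} V.
Arguments unit_ball {R} V.

(* The weak* topology that a map [T : E -> V^*] pulls back to [E], i.e. the
   coarsest one making [fun z => T z v] continuous for every [v : V]. *)
Definition weak_star_topology (R : realType) (V : normedModType R)
    (E : choiceType) (T : E -> dual V) :=
  initial_topology (fun z => dual_val (T z) : {ptws V -> R}).

HB.instance Definition _ (R : realType) (V : normedModType R)
    (E : choiceType) (T : E -> dual V) :=
  Topological.copy (weak_star_topology T)
    (initial_topology (fun z => dual_val (T z) : {ptws V -> R})).

Definition linear_isometry_onto (R : realType) (V W : normedModType R)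
    (T : V -> W) :=
  [/\ linear T, forall v, `|T v| = `|v| & forall w, exists v, T v = w].

Definition isometric (R : realType) (V W : normedModType R) :=
  exists T : V -> W, linear_isometry_onto T.

Section ell1.
Variables (R : realType) (I : choiceType).

Definition ell1_pred : {pred I -> R} :=
  [pred z : I -> R | `[< summable [set: I] (EFin \o z) >]].

Lemma esum_normZ (a : R) (z : I -> R) :
  (\esum_(i in [set: I]) `|(a *: z) i|%:E =
   `|a|%:E * \esum_(i in [set: I]) `|z i|%:E)%E.
Proof.
rewrite /esum -ereal_supZl//; last first.
  apply/set0P; exists (\sum_(i \in set0) `|z i|%:E)%E.
  by exists set0 => //; exact: fsets_set0.
congr ereal_sup; rewrite image_comp; apply: eq_imagel => A _ /=.
rewrite ge0_mule_fsumr//.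
by apply: eq_fsbigr => i _; rewrite -EFinM -normrM.
Qed.

Lemma ell1_submod_closed : submod_closed ell1_pred.
Proof.
split.
  by apply/asboolP; rewrite /summable esum1// => i _; rewrite /= normr0.
move=> a z w /asboolP sz /asboolP sw; apply/asboolP.
have saz : summable [set: I] (EFin \o (a *: z)).
  by rewrite /summable esum_normZ lte_mul_pinfty.
exact: (summableD saz sw).
Qed.

HB.instance Definition _ :=
  GRing.isSubmodClosed.Build R (I -> R) ell1_pred ell1_submod_closed.

Record ell1 := Ell1 { ell1_val :> I -> R ; _ : ell1_val \in ell1_pred }.

HB.instance Definition _ := [isSub for ell1_val].
HB.instance Definition _ := [Choice of ell1 by <:].
HB.instance Definition _ := [SubChoice_isSubLmodule of ell1 by <:].

Lemma ell1_summable (z : ell1) : summable [set: I] (EFin \o z).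
Proof. by case: z => z /= /asboolP. Qed.

Definition ell1_norm (z : ell1) : R := fine (\esum_(i in [set: I]) `|z i|%:E).

Lemma EFin_ell1_norm (z : ell1) :
  (ell1_norm z)%:E = (\esum_(i in [set: I]) `|z i|%:E)%E.
Proof. rewrite fineK//.
exact: etrans (esym (summableE _ (EFin \o z))) (ell1_summable z). Qed.

Lemma ell1_normD (z w : ell1) : ell1_norm (z + w) <= ell1_norm z + ell1_norm w.
Proof.
rewrite -lee_fin EFinD !EFin_ell1_norm -esumD//; apply: le_esum => i _.
by rewrite -EFinD lee_fin; exact: ler_normD.
Qed.

Lemma ell1_normZ (a : R) (z : ell1) : ell1_norm (a *: z) = `|a| * ell1_norm z.
Proof. by apply: EFin_inj; rewrite EFinM !EFin_ell1_norm -esum_normZ. Qed.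

Lemma ell1_norm0_eq0 (z : ell1) : ell1_norm z = 0 -> z = 0.
Proof.
move=> z0; apply/val_inj/funext => i /=; apply/eqP.
rewrite -normr_le0 -lee_fin -z0 EFin_ell1_norm.
rewrite -[leLHS](@esum_set1 _ _ i (fun i => `|z i|%:E))//.
rewrite [leLHS]esum_mkcond; apply: le_esum => j _.
by case: ifPn.
Qed.

HB.instance Definition _ :=
  Lmodule_isNormed.Build R ell1 ell1_normD ell1_normZ ell1_norm0_eq0.

Definition ell1_basis_fun (i : I) : I -> R := fun k => (k == i)%:R.

Lemma ell1_basis_subproof i : ell1_basis_fun i \in ell1_pred.
Proof.
apply/asboolP; rewrite /summable.
rewrite (_ : esum _ _ = \esum_(j in [set i]) (1%:E : \bar R))%E.
  by rewrite esum_set1// ltry.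
rewrite [RHS]esum_mkcond; apply: eq_esum => j _ /=.
rewrite /ell1_basis_fun; case: ifPn => [|].
  by rewrite inE => ->; rewrite eqxx normr1.
by rewrite notin_setE => /eqP/negbTE ->; rewrite normr0.
Qed.

Definition ell1_basis i : ell1 := Ell1 (ell1_basis_subproof i).

End ell1.
Arguments ell1_basis R {I} i.

Section double_family.
Variables (R : realType) (n : nat).
Implicit Type z : ell1 R ('I_n * nat)%type.

Lemma esum_double_family z : (\esum_(k in [set: 'I_n * nat]) `|z k|%:E =
  \sum_(i < n) \esum_(j in [set: nat]) `|z (i, j)|%:E)%E.
Proof.
rewrite fsbig_seq ?index_enum_uniq// (_ : [set` _] = [set: 'I_n]); last first.
  by apply/seteqP; split => // i _; rewrite /= mem_index_enum.
rewrite -esum_fset; [|exact: finite_finset|by move=> i _; exact: esum_ge0].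
rewrite esum_esum// (_ : _ `*`` _ = setT); last exact/seteqP.
by apply: eq_esum => -[].
Qed.

Lemma summable_row z i : summable xpredT (fun j => `|z (i, j)|%:E).
Proof.
suff -> : (fun j : nat => is_true (xpredT j)) = setT.
  rewrite /summable; under eq_esum do rewrite abse_EFin normr_id.
  have := ell1_summable z; rewrite /summable esum_double_family.
  apply: le_lt_trans.
  by rewrite (bigD1 i)//= leeDl// sume_ge0// => k _; exact: esum_ge0.
exact/seteqP.
Qed.

Lemma is_cvg_row z i : cvgn (series (fun j => `|z (i, j)|)).
Proof. exact: (summable_cvg _ (summable_row z i)). Qed.

Lemma ell1_normE z : `|z| = \sum_(i < n) limn (series (fun j => `|z (i, j)|)).
Proof.
apply: EFin_inj; rewrite [LHS]EFin_ell1_norm esum_double_family -sumEFin.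
apply: eq_bigr => i _.
by rewrite -nneseries_esumT// (summable_nneseries_lim _ (summable_row z i)).
Qed.

End double_family.

(* With indices counted from 0, [omega_pt i j] is the point
   (1/(i+1), 1/(j+1)) and [omega_lim_pt i] is (1/(i+1), 0). The product topology
   of [R * R] is the Euclidean one. *)
Section Omega.
Variables (R : realType) (n : nat).

Definition omega_pair (ij : 'I_n * nat) : R * R :=
  (ij.1.+1%:R^-1, ij.2.+1%:R^-1).

Definition omega_lim_pair (i : 'I_n) : R * R := (i.+1%:R^-1, 0).

Definition Omega0 : set (R * R) := range omega_pair.

Definition Omega : set (R * R) := Omega0 `|` range omega_lim_pair.

Lemma omega_pair_subproof ij : omega_pair ij \in Omega.
Proof. by rewrite inE; left; exists ij. Qed.

Lemma omega_lim_pair_subproof i : omega_lim_pair i \in Omega.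
Proof. by rewrite inE; right; exists i. Qed.

Definition omega_pt i j : Omega :=
  exist (fun p => p \in Omega) _ (omega_pair_subproof (i, j)).

Definition omega_lim_pt i : Omega :=
  exist (fun p => p \in Omega) _ (omega_lim_pair_subproof i).

Lemma OmegaP (p : Omega) :
  (exists i j, p = omega_pt i j) \/ exists i, p = omega_lim_pt i.
Proof.
case: p => p pO; have := pO; rewrite inE => -[[[i j] _ ijp]|[i _ ip]].
  by left; exists i, j; apply/val_inj.
by right; exists i; apply/val_inj.
Qed.

Lemma cvg_omega_pt i : omega_pt i j @[j --> \oo] --> omega_lim_pt i.
Proof.
move=> A [_ [[B oB <-] Bi BA]].
have Bnbhs : nbhs (omega_lim_pair i) B by exact: open_nbhs_nbhs.
have : omega_pair (i, j) @[j --> \oo] --> omega_lim_pair i.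
  have h1 : (fun=> i.+1%:R^-1 : R) @ \oo --> (i.+1%:R^-1 : R) by exact: cvg_cst.
  exact: (cvg_pair h1 (@cvg_harmonic R)).
move=> /(_ _ Bnbhs); rewrite !nbhs_simpl/=; apply: filterS => j Bj.
exact: BA.
Qed.

Lemma continuous_Omega_bounded (f : Omega -> R) : continuous f ->
  bounded_on [set: Omega] f.
Proof.
move=> cf.
have /(_ _)/cid-/all_sig[M fM] i :
    exists M : R, forall j, `|f (omega_pt i j)| <= M.
  have : cvgn (fun j => f (omega_pt i j)).
    exact: cvgP _ (cvg_comp _ _ (@cvg_omega_pt i) (cf (omega_lim_pt i))).
  by move=> /cvg_seq_bounded/pinfty_ex_gt0[M _ fM]; exists M => j; exact: fM.
have M0 i : 0 <= M i by exact: le_trans (fM i 0).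
exists (\sum_i (M i + `|f (omega_lim_pt i)|)) => p _.
case: (OmegaP p) => [[i [j ->]]|[i ->]]; rewrite (bigD1 i)//=.
  rewrite -addrA (le_trans (fM i j))// lerDl addr_ge0//.
  by rewrite sumr_ge0// => k _; rewrite addr_ge0.
rewrite [M i + _]addrC -addrA lerDl addr_ge0//.
by rewrite sumr_ge0// => k _; rewrite addr_ge0.
Qed.

Definition COmega_pred : {pred Omega -> R} :=
  [pred f : Omega -> R | `[< continuous f >]].

Lemma COmega_submod_closed : submod_closed COmega_pred.
Proof.
split; first by apply/asboolP; exact: cst_continuous.
move=> a f g /asboolP cf /asboolP cg; apply/asboolP => p.
apply: (@continuousD _ _ _ (a *: f) g); last exact: cg.
exact: (@continuousZr _ _ _ f a p (cf p)).
Qed.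

HB.instance Definition _ := GRing.isSubmodClosed.Build R (Omega -> R)
  COmega_pred COmega_submod_closed.

Record COmega := MkCOmega {
  COmega_val :> Omega -> R ; _ : COmega_val \in COmega_pred }.

HB.instance Definition _ := [isSub for COmega_val].
HB.instance Definition _ := [Choice of COmega by <:].
HB.instance Definition _ := [SubChoice_isSubLmodule of COmega by <:].

Lemma COmega_continuous (f : COmega) : continuous f.
Proof. by case: f => f /= /asboolP. Qed.

Lemma COmega_bounded (f : COmega) : bounded_on [set: Omega] f.
Proof. exact/continuous_Omega_bounded/COmega_continuous. Qed.

Definition COmega_norm (f : COmega) : R := sup_norm [set: Omega] f.

Lemma COmega_normD (f g : COmega) :
  COmega_norm (f + g) <= COmega_norm f + COmega_norm g.
Proof. exact: (sup_normD (COmega_bounded f) (COmega_bounded g)). Qed.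

Lemma COmega_normZ (a : R) (f : COmega) :
  COmega_norm (a *: f) = `|a| * COmega_norm f.
Proof. exact: (sup_normZ a (COmega_bounded f)). Qed.

Lemma COmega_norm0_eq0 (f : COmega) : COmega_norm f = 0 -> f = 0.
Proof.
move=> f0; apply/val_inj/funext => p /=; apply/eqP.
by rewrite -normr_le0 -f0; exact: (le_sup_norm (COmega_bounded f)).
Qed.

HB.instance Definition _ :=
  Lmodule_isNormed.Build R COmega COmega_normD COmega_normZ COmega_norm0_eq0.

Implicit Type z : ell1 R ('I_n * nat)%type.

Definition pairing (z : ell1 R ('I_n * nat)%type) (f : COmega) : R :=
  \sum_(i < n) limn (series (fun j => f (omega_pt i j) * z (i, j))).

Lemma is_cvg_pairing_row z f i :
  cvgn (series (fun j => COmega_val f (omega_pt i j) * z (i, j))).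
Proof.
have [M fM] := COmega_bounded f.
apply: normed_cvg; apply: (@series_le_cvg _ _ (M *: (fun j => `|z (i, j)|))).
- by move=> j; exact: normr_ge0.
- move=> j; apply: mulr_ge0 (normr_ge0 _).
  exact: le_trans (normr_ge0 _) (fM (omega_pt i j) Logic.I).
- by move=> j; rewrite [leLHS]normrM ler_wpM2r// fM.
- exact: (@is_cvg_seriesZ R _ M (@is_cvg_row R n z i)).
Qed.

Lemma pairing_linearr z : linear (pairing z).
Proof.
move=> a f g; rewrite /pairing scaler_sumr -big_split/=; apply: eq_bigr => i _.
have cf := is_cvg_pairing_row (z := z) (f := f) (i := i).
have cg := is_cvg_pairing_row (z := z) (f := g) (i := i).
rewrite -[X in _ = X + _](lim_seriesZ a cf) -lim_seriesD//; last first.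
  exact: (@is_cvg_seriesZ R _ a cf).
congr (limn (series _)); apply/funext => j.
by rewrite /= !fctE/= mulrDl scalerAl.
Qed.

HB.instance Definition _ z :=
  GRing.isLinear.Build R COmega R _ (pairing z) (pairing_linearr z).

End Omega.

Section W.
Variables (R : realType) (n : nat) (x : 'I_n -> ell1 R ('I_n * nat)%type).

Definition W_pred : {pred COmega R n} :=
  [pred f : COmega R n |
    `[< forall s, f (omega_lim_pt R s) = pairing (x s) f >]].

Lemma W_submod_closed : submod_closed W_pred.
Proof.
split; first by apply/asboolP => s; rewrite linear0.
move=> a f g /asboolP Wf /asboolP Wg; apply/asboolP => s.
by rewrite [RHS](pairing_linearr (x s) a f g) -Wf -Wg.
Qed.

HB.instance Definition _ :=
  GRing.isSubmodClosed.Build R (COmega R n) W_pred W_submod_closed.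

Record W := MkW { W_val :> COmega R n ; _ : W_val \in W_pred }.

HB.instance Definition _ := [isSub for W_val].
HB.instance Definition _ := [Choice of W by <:].
HB.instance Definition _ := [SubChoice_isSubLmodule of W by <:].

Definition W_norm (f : W) : R := `|W_val f|.

Lemma W_normD (f g : W) : W_norm (f + g) <= W_norm f + W_norm g.
Proof. exact: ler_normD. Qed.

Lemma W_normZ (a : R) (f : W) : W_norm (a *: f) = `|a| * W_norm f.
Proof. exact: normrZ. Qed.

Lemma W_norm0_eq0 (f : W) : W_norm f = 0 -> f = 0.
Proof. by move=> /normr0_eq0 f0; exact/val_inj. Qed.

HB.instance Definition _ :=
  Lmodule_isNormed.Build R W W_normD W_normZ W_norm0_eq0.

End W.

(* Main.v *)
(* Let [u i K] be the indicator of the part of row [i] with column index at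
   least [K], limit point included. Since [pairing (x s) (u i K)] tends to 0,
   for large [K] the matrix of these numbers is a contraction, so that every
   [g] in C(Omega) has a unique correction [g + \sum_i d i *: u i K] lying in
   [W x]; this is a bounded linear projection of C(Omega) onto [W x].
   Composing a functional on [W x] with it gives a functional on C(Omega),
   which is a pairing with some [w] plus a combination of evaluations at the
   limit points; on [W x] the latter are pairings with the [x s], so [phi] is
   onto. If [g] is supported on the first [K] columns with [`|g| <= 1], then the
   correction still has norm at most 1, because [`|x s| <= 1] and the
   contraction constant is at most 1/2. Taking for [g] the signs of [z] shows
   that [phi] is isometric. Finally [phi] of a basis vector is evaluation at a
   point, which gives the weak* convergence; as the topology is Hausdorff, there
   are no other limit points. *)

Require Import Defs.
From HB Require Import structures.
From mathcomp Require Import all_boot all_order all_algebra.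
From mathcomp Require Import all_classical all_reals all_analysis.
From mathcomp Require Import ring lra zify.

Set Implicit Arguments.
Unset Strict Implicit.
Unset Printing Implicit Defensive.

Import Order.TTheory GRing.Theory Num.Theory.
Import numFieldNormedType.Exports.

Local Open Scope classical_set_scope.
Local Open Scope ring_scope.

(** * Tent functions at the points 1/(j+1) *)

Section tent.
Variable R : realType.

(* [(j.+1 * j.+2)^-1] is the distance from [1/(j+1)] to the closest other point
   of the set {0, 1, 1/2, 1/3, ...}. *)
Definition tent (j : nat) (y : R) : R :=
  Num.max 0 (1 - (j.+1 * j.+2)%:R * `|y - j.+1%:R^-1|).

Lemma tent0 j : tent j 0 = 0.
Proof.
apply/max_idPl; rewrite sub0r normrN ger0_norm ?invr_ge0// mulnC natrM -mulrA.
by rewrite mulfV ?pnatr_eq0// mulr1 subr_le0 ler1n.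
Qed.

Lemma tent_inv j k : tent j k.+1%:R^-1 = (k == j)%:R.
Proof.
have [->|kj] := eqVneq k j.
  by rewrite /tent subrr normr0 mulr0 subr0; apply/max_idPr.
apply/max_idPl; rewrite subr_le0.
have d0 m : (m.+1%:R : R) != 0 by rewrite pnatr_eq0.
rewrite (_ : _ - _ = (j%:R - k%:R) / (k.+1 * j.+1)%:R); last first.
  by rewrite natrM -!natr1; field; rewrite !natr1 !d0.
rewrite normrM normfV [X in _ / X]ger0_norm ?ler0n// mulrA.
rewrite ler_pdivlMr ?ltr0n// mul1r.
have -> : `|j%:R - k%:R : R| = (`|j - k|%N)%:R :> R.
  by rewrite natr_absz intr_norm intrB.
rewrite -natrM ler_nat.
(* What remains is (k+1)(j+1) <= (j+1)(j+2)|j-k| in the integers, with equality at the nearest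
   neighbour k = j+1. *)
move: kj; rewrite neq_ltn => /orP[kj|jk].
  have : (1 <= `|j - k|%N)%N by lia.
  nia.
have [d ->] : exists d, k = (j + d.+1)%N by exists (k - j.+1)%N; lia.
have -> : (`|j - (j + d.+1)%N|%N) = d.+1 by lia.
nia.
Qed.

Lemma continuous_tent j : continuous (tent j).
Proof.
move=> y; pose g (y : R) : R := 1 - (j.+1 * j.+2)%:R * `|y - j.+1%:R^-1|.
have cg : {for y, continuous g}.
  apply: cvgB; first exact: cvg_cst.
  apply: cvgM; first exact: cvg_cst.
  apply: cvg_norm; apply: cvgB; [exact: cvg_id|exact: cvg_cst].
exact: (continuous_max (@cst_continuous R R 0 y) cg).
Qed.

End tent.

(** * Indicators of points and of row tails, and their pairings *)

Section COmega_theory.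
Variables (R : realType) (n : nat).
Implicit Types (f g : COmega R n) (z : ell1 R ('I_n * nat)%type).
Implicit Types (i s : 'I_n) (j K : nat).

Lemma le_COmega_norm f p : `|f p| <= `|f|.
Proof. exact: (le_sup_norm (COmega_bounded f)). Qed.

Lemma COmega_norm_le f (M : R) : 0 <= M ->
  (forall i j, `|f (omega_pt R i j)| <= M) ->
  (forall i, `|f (omega_lim_pt R i)| <= M) -> `|f| <= M.
Proof.
move=> M0 fM fM'; apply: sup_norm_le => // p _.
by case: (OmegaP p) => [[i [j ->]]|[i ->]].
Qed.

Lemma continuous_Omega_coord (k : R -> R) (l : R -> R) :
  continuous k -> continuous l ->
  (fun p : @Omega R n => k (\val p).1 * l (\val p).2) \in @COmega_pred R n.
Proof.
move=> ck cl; apply/asboolP => p.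
have cv : {for p, continuous (fun q : @Omega R n => \val q)}.
  exact: initial_continuous.
have c1 : (\val q).1 @[q --> p] --> (\val p).1.
  exact: (cvg_comp _ _ cv (@cvg_fst _ _ _ _ _)).
have c2 : (\val q).2 @[q --> p] --> (\val p).2.
  exact: (cvg_comp _ _ cv (@cvg_snd _ _ _ _ _)).
have k1 := cvg_comp _ _ c1 (ck (\val p).1).
have l2 := cvg_comp _ _ c2 (cl (\val p).2).
exact: (@cvgM _ _ _ (@nbhs_filter (@Omega R n) p) _ _ _ _ k1 l2).
Qed.

(* Locking keeps simplification from exposing the tent functions. *)
Definition omega_delta i j : COmega R n := locked (MkCOmega
  (continuous_Omega_coord (@continuous_tent R i) (@continuous_tent R j))).

Definition omega_row i : COmega R n := locked (MkCOmega
  (continuous_Omega_coord (@continuous_tent R i) (@cst_continuous R R 1))).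

Lemma omega_delta_pt i j i' j' :
  omega_delta i j (omega_pt R i' j') = ((i' == i) && (j' == j))%:R.
Proof. by rewrite /omega_delta -lock /= !tent_inv -natrM mulnb. Qed.

Lemma omega_delta_lim i j i' : omega_delta i j (omega_lim_pt R i') = 0.
Proof. by rewrite /omega_delta -lock /= tent0 mulr0. Qed.

Lemma omega_row_pt i i' j' : omega_row i (omega_pt R i' j') = (i' == i)%:R.
Proof. by rewrite /omega_row -lock /= !tent_inv mulr1. Qed.

Lemma omega_row_lim i i' : omega_row i (omega_lim_pt R i') = (i' == i)%:R.
Proof. by rewrite /omega_row -lock /= !tent_inv mulr1. Qed.

Lemma lim_series_eventually0 (u : nat -> R) K :
  (forall j, (K <= j)%N -> u j = 0) -> limn (series u) = \sum_(j < K) u j.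
Proof.
move=> u0; apply: lim_near_cst => //; exists K => // m /= Km.
rewrite /series/= -(big_mkord xpredT) (big_cat_nat (leq0n K) Km)//=.
rewrite [X in _ + X]big_nat_cond [X in _ + X]big1 ?addr0// => j.
by rewrite andbT => /andP[Kj _]; exact: u0.
Qed.

Lemma pairing_le z f : `|pairing z f| <= `|f| * `|z|.
Proof.
rewrite ell1_normE mulr_sumr (le_trans (ler_norm_sum _ _ _))//.
apply: ler_sum => i _.
have cz : cvgn (series (`|f| *: (fun j => `|z (i, j)|))).
  exact: (@is_cvg_seriesZ R _ `|f| (@is_cvg_row R n z i)).
have le_term j : `|f (omega_pt R i j) * z (i, j)| <= `|f| * `|z (i, j)|.
  by rewrite normrM ler_wpM2r// le_COmega_norm.
have cn : cvgn [normed series (fun j => f (omega_pt R i j) * z (i, j))].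
  apply: (@series_le_cvg _ _ (`|f| *: (fun j => `|z (i, j)|))) => //.
    by move=> j; exact: normr_ge0.
  by move=> j; apply: mulr_ge0; exact: normr_ge0.
apply: le_trans (lim_series_norm cn) _.
rewrite -[leRHS](lim_seriesZ _ (@is_cvg_row R n z i)).
exact: lim_series_le.
Qed.

Lemma pairingDr z f g : pairing z (f + g) = pairing z f + pairing z g.
Proof. exact: (linearD (pairing z)). Qed.

Lemma pairing_delta z i j : pairing z (omega_delta i j) = z (i, j).
Proof.
rewrite /pairing (bigD1 i)//= [X in _ + X]big1 ?addr0 => [|i' i'i]; last first.
  rewrite (@lim_series_eventually0 _ 0) ?big_ord0// => j' _.
  by rewrite omega_delta_pt (negbTE i'i) mul0r.
rewrite (@lim_series_eventually0 _ j.+1) => [|j' jj'].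
  rewrite big_ord_recr big1 => [|j' _]; rewrite omega_delta_pt eqxx/=.
    by rewrite eqxx mul1r add0r.
  by rewrite ltn_eqF ?mul0r.
by rewrite omega_delta_pt gtn_eqF// andbF mul0r.
Qed.

Lemma pairing_row z i :
  pairing z (omega_row i) = limn (series (fun j => z (i, j))).
Proof.
rewrite /pairing (bigD1 i)//= [X in _ + X]big1 ?addr0 => [|i' i'i]; last first.
  rewrite (@lim_series_eventually0 _ 0) ?big_ord0// => j' _.
  by rewrite omega_row_pt (negbTE i'i) mul0r.
congr (limn (series _)); apply/funext => j.
by rewrite omega_row_pt eqxx mul1r.
Qed.

(** The [u i K] of the overview. Built as a difference, it is continuous for free and pairs with [z]
    as a series remainder. *)
Definition omega_tail i K : COmega R n :=
  locked (omega_row i - \sum_(j < K) omega_delta i j).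

Lemma omega_tailE i K :
  omega_tail i K = omega_row i - \sum_(j < K) omega_delta i j.
Proof. by rewrite /omega_tail -lock. Qed.

Lemma COmega_sumE (I : Type) (r : seq I) (P : pred I) (F : I -> COmega R n) p :
  (\sum_(k <- r | P k) F k) p = \sum_(k <- r | P k) F k p.
Proof. exact: (big_morph (fun f : COmega R n => f p)). Qed.

Lemma COmegaDE f g p : (f + g) p = f p + g p.
Proof. by []. Qed.

Lemma COmegaBE f g p : (f - g) p = f p - g p.
Proof. by []. Qed.

Lemma COmegaZE (a : R) f p : (a *: f) p = a * f p.
Proof. by []. Qed.

Lemma omega_tail_pt i K i' j' :
  omega_tail i K (omega_pt R i' j') = ((i' == i) && (K <= j')%N)%:R.
Proof.
rewrite omega_tailE COmegaBE COmega_sumE omega_row_pt.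
under eq_bigr do rewrite omega_delta_pt.
have [_|_] /= := eqVneq i' i; last by rewrite big1 ?subr0.
have [Kj|jK] := leqP K j'.
  rewrite big1 ?subr0// => j _; by rewrite gtn_eqF// (leq_trans (ltn_ord j)).
rewrite (bigD1 (Ordinal jK))//= eqxx big1 ?addr0 ?subrr// => j.
by rewrite -val_eqE/= eq_sym => /negbTE ->.
Qed.

Lemma omega_tail_lim i K i' :
  omega_tail i K (omega_lim_pt R i') = (i' == i)%:R.
Proof.
rewrite omega_tailE COmegaBE COmega_sumE omega_row_lim big1 ?subr0// => j _.
exact: omega_delta_lim.
Qed.

(** The pairing is the remainder after [K] terms of the series of row [i] of [z], which converges
    absolutely. *)
Lemma cvg_pairing_tail z i : pairing z (omega_tail i K) @[K --> \oo] --> 0.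
Proof.
have -> : (fun K => pairing z (omega_tail i K)) =
    (fun K => pairing z (omega_row i) - series (fun j => z (i, j)) K).
  apply/funext => K; rewrite omega_tailE (linearB (pairing z)).
  rewrite (linear_sum (pairing z)) /series/= big_mkord.
    by congr (_ - _); apply: eq_bigr => j _; exact: pairing_delta.
rewrite -(subrr (pairing z (omega_row i))); apply: cvgB; first exact: cvg_cst.
by rewrite pairing_row; apply: normed_cvg; exact: is_cvg_row.
Qed.

(** There are finitely many rows, so bounding the partial sums of each row separately suffices. *)
Lemma ell1P (w : 'I_n * nat -> R) (C : R) :
  (forall i K, \sum_(j < K) `|w (i, j : nat)| <= C) -> w \in @ell1_pred R _.
Proof.
move=> wC; apply/asboolP; rewrite /summable.
rewrite (_ : esum _ _ =
    \sum_(i < n) \esum_(j in [set: nat]) `|w (i, j)|%:E)%E; last first.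
  rewrite fsbig_seq ?index_enum_uniq// (_ : [set` _] = [set: 'I_n]); last first.
    by apply/seteqP; split => // i _; rewrite /= mem_index_enum.
  rewrite -esum_fset; [|exact: finite_finset|by move=> i _; exact: esum_ge0].
  rewrite esum_esum// (_ : _ `*`` _ = setT); last exact/seteqP.
  by apply: eq_esum => -[].
apply/lte_sum_pinfty => i _.
rewrite -nneseries_esumT//; apply: (@le_lt_trans _ _ C%:E); last exact: ltry.
apply: lime_le; first exact: is_cvg_nneseries.
by apply: nearW => K; rewrite big_mkord sumEFin lee_fin.
Qed.

End COmega_theory.
Arguments omega_delta R {n} i j.
Arguments omega_row R {n} i.
Arguments omega_tail R {n} i K.

(** * Step functions and the dual of C(Omega) *)

Section step_functions.
Variables (R : realType) (n : nat).
Implicit Types (f g : COmega R n) (z : ell1 R ('I_n * nat)%type).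
Implicit Types (i s : 'I_n) (j K : nat) (c : 'I_n -> R) (v : 'I_n -> nat -> R).

Definition omega_fin K v : COmega R n :=
  \sum_i \sum_(j < K) v i j *: omega_delta R i j.

(** The sums [omega_fin K v + omega_const K c] are all the functions that are constant on each row
    from column [K] on, limit point included. *)
Definition omega_const K c : COmega R n := \sum_i c i *: omega_tail R i K.

Lemma omega_fin_pt K v i j :
  omega_fin K v (omega_pt R i j) = if (j < K)%N then v i j else 0.
Proof.
rewrite COmega_sumE (bigD1 i)//=.
rewrite [X in _ + X]big1 ?addr0 => [|i' i'i]; last first.
  rewrite COmega_sumE big1// => j' _.
  by rewrite COmegaZE omega_delta_pt eq_sym (negbTE i'i) mulr0.
rewrite COmega_sumE.
under eq_bigr do rewrite COmegaZE omega_delta_pt eqxx/=.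
case: ltnP => [jK|Kj].
  rewrite (bigD1 (Ordinal jK))//= eqxx mulr1 big1 ?addr0// => j'.
  by rewrite -val_eqE/= eq_sym => /negbTE ->; rewrite mulr0.
rewrite big1// => j' _.
by rewrite gtn_eqF ?mulr0// (leq_trans (ltn_ord j')).
Qed.

Lemma omega_fin_lim K v i : omega_fin K v (omega_lim_pt R i) = 0.
Proof.
rewrite COmega_sumE big1// => i' _; rewrite COmega_sumE big1// => j' _.
by rewrite COmegaZE omega_delta_lim mulr0.
Qed.

Lemma omega_const_pt K c i j :
  omega_const K c (omega_pt R i j) = if (j < K)%N then 0 else c i.
Proof.
rewrite COmega_sumE (bigD1 i)//=.
rewrite [X in _ + X]big1 ?addr0 => [|i' i'i]; last first.
  by rewrite [LHS]COmegaZE omega_tail_pt eq_sym (negbTE i'i) mulr0.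
by rewrite [LHS]COmegaZE omega_tail_pt eqxx; case: ltnP; rewrite (mulr0, mulr1).
Qed.

Lemma omega_const_lim K c i : omega_const K c (omega_lim_pt R i) = c i.
Proof.
rewrite COmega_sumE (bigD1 i)//= [X in _ + X]big1 ?addr0 => [|i' /= i'i].
  by rewrite [LHS]COmegaZE omega_tail_lim eqxx mulr1.
by rewrite [LHS]COmegaZE omega_tail_lim eq_sym (negbTE i'i) mulr0.
Qed.

(** The two summands have disjoint supports, so their norms combine as a maximum; this keeps the
    bound at 1 in the isometry proof. *)
Lemma omega_step_norm_le K v c (M : R) : 0 <= M ->
  (forall i j, (j < K)%N -> `|v i j| <= M) -> (forall i, `|c i| <= M) ->
  `|omega_fin K v + omega_const K c| <= M.
Proof.
move=> M0 vM cM; apply: COmega_norm_le => // [i j|i]; rewrite COmegaDE.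
  rewrite omega_fin_pt omega_const_pt.
  by case: ifPn => [/vM|_]; rewrite ?addr0 ?add0r.
by rewrite omega_fin_lim omega_const_lim add0r.
Qed.

(** The error lives in the columns from [K] on, where it is the difference between [f] and its limit
    along the row; one [K] serves the finitely many rows. *)
Lemma cvg_omega_step f :
  omega_fin K (fun i j => f (omega_pt R i j)) +
    omega_const K (fun i => f (omega_lim_pt R i)) @[K --> \oo] --> f.
Proof.
apply/cvgrPdist_le => e e0.
have : \forall K \near \oo, forall i,
    `|f (omega_lim_pt R i) - f (omega_pt R i K)| <= e.
  apply: filter_forall => i.
  have : f (omega_pt R i j) @[j --> \oo] --> f (omega_lim_pt R i).
    exact: (cvg_comp _ _ (@cvg_omega_pt R n i) (@COmega_continuous _ _ f _)).
  by move=> /cvgrPdist_le; apply.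
move=> [N _ fN]; exists N => // K /= NK.
apply: COmega_norm_le => [|i j|i]; first exact: ltW.
  rewrite COmegaBE COmegaDE omega_fin_pt omega_const_pt.
  case: ltnP => [_|Kj]; first by rewrite addr0 subrr normr0 ltW.
  by rewrite add0r distrC fN//= (leq_trans NK).
rewrite COmegaBE COmegaDE omega_fin_lim omega_const_lim add0r subrr normr0.
exact: ltW.
Qed.

Lemma linear_omega_fin (L : {linear COmega R n -> R}) K v :
  L (omega_fin K v) = \sum_i \sum_(j < K) v i j * L (omega_delta R i j).
Proof.
rewrite linear_sum; apply: eq_bigr => i _; rewrite linear_sum.
by apply: eq_bigr => j _; rewrite linearZ.
Qed.

Lemma linear_omega_const (L : {linear COmega R n -> R}) K c :
  L (omega_const K c) = \sum_i c i * L (omega_tail R i K).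
Proof. by rewrite linear_sum; apply: eq_bigr => i _; rewrite linearZ. Qed.

Lemma linear_omega_tail (L : {linear COmega R n -> R}) i K :
  L (omega_tail R i K) =
  L (omega_row R i) - \sum_(j < K) L (omega_delta R i j).
Proof. by rewrite omega_tailE linearB linear_sum. Qed.

(** Riesz representation on [Omega]: [w] carries the masses at the isolated points, and [m i] is the
    mass at the limit point of row [i], namely that of the whole row minus the sum of [w] along
    it. *)
Lemma COmega_dual_repr (L : {linear COmega R n -> R}) (C : R) :
  (forall f, `|L f| <= C * `|f|) ->
  exists (w : ell1 R ('I_n * nat)%type) (m : 'I_n -> R),
    forall f, L f = pairing w f + \sum_i m i * f (omega_lim_pt R i).
Proof.
move=> LC; pose w (ij : 'I_n * nat) := L (omega_delta R ij.1 ij.2).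
have wC i K : \sum_(j < K) `|w (i, j : nat)| <= `|C|.
  (* Testing [L] on the signs of [w] in the first [K] columns bounds the partial sums. The absolute
     value of [C] spares a proof that [C] is nonnegative. *)
  pose g := omega_fin K (fun i j => Num.sg (w (i, j))) + omega_const K (cst 0).
  have g1 : `|g| <= 1.
    apply: omega_step_norm_le => // [k j _|k]; last by rewrite normr0.
    by rewrite normr_sg; case: eqP.
  have Lg : L g = \sum_k \sum_(j < K) `|w (k, j : nat)|.
    rewrite linearD linear_omega_fin linear_omega_const.
    rewrite [X in _ + X]big1 ?addr0 => [|k _]; last by rewrite mul0r.
    by apply: eq_bigr => k _; apply: eq_bigr => j _; rewrite normrEsg.
  have : L g <= `|C|.
    rewrite (le_trans (ler_norm _))// (le_trans (LC _))//.
    rewrite (le_trans (ler_norm _))// normrM normr_id -[leRHS]mulr1.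
    exact: ler_wpM2l.
  apply: le_trans; rewrite Lg (bigD1 i)//= lerDl.
  by apply: sumr_ge0 => k _; apply: sumr_ge0.
pose W : ell1 R ('I_n * nat)%type := Ell1 (ell1P wC).
pose m i := L (omega_row R i) - limn (series (fun j => W (i, j))).
exists W, m => f.
pose fK K := omega_fin K (fun i j => f (omega_pt R i j)) +
    omega_const K (fun i => f (omega_lim_pt R i)).
have Lcvg : L (fK K) @[K --> \oo] --> L f.
  have Lc : continuous L.
    apply/linear_bounded_continuous/bounded_funP => r.
    exists (`|C| * r) => g gr; rewrite (le_trans (LC _))//.
    rewrite (le_trans (ler_norm _))// normrM normr_id.
    exact: ler_wpM2l.
  exact: (cvg_comp _ _ (@cvg_omega_step f) (Lc f)).
apply: (cvg_unique _ Lcvg) => //.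
(* [L] of a tail is the row mass minus a partial sum of [W], so the second sum produces the [m i] in
   the limit. *)
have -> : (fun K => L (fK K)) = (fun K =>
    \sum_i series (fun j => f (omega_pt R i j) * W (i, j)) K +
    \sum_i f (omega_lim_pt R i) *
      (L (omega_row R i) - series (fun j => W (i, j)) K)).
  apply/funext => K; rewrite linearD linear_omega_fin linear_omega_const.
  congr (_ + _); apply: eq_bigr => i _; rewrite /series/= big_mkord//.
  by rewrite linear_omega_tail.
apply: cvgD; apply: cvg_big => [|i _].
- exact: add_continuous.
- exact: (@is_cvg_pairing_row _ _ W f i).
- exact: add_continuous.
- rewrite mulrC; apply: cvgM; first exact: cvg_cst.
  apply: cvgB; first exact: cvg_cst.
  by apply: normed_cvg; exact: is_cvg_row.
Qed.

End step_functions.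

(** * The projection of C(Omega) onto [W x] *)

Section predual.
Variables (R : realType) (n : nat) (x : 'I_n -> ell1 R ('I_n * nat)%type).
Implicit Types (f g : COmega R n) (z : ell1 R ('I_n * nat)%type).
Implicit Types (i s : 'I_n) (K : nat) (c : 'I_n -> R).

Definition tail_mx K : 'M[R]_n :=
  \matrix_(i, s) pairing (x s) (omega_tail R i K).

(** The sums run down columns because [tail_mx K] multiplies row vectors: sending [d] to
    [d *m tail_mx K] is then a contraction by 1/2 in the maximum norm. *)
Definition small_tail K := forall s, \sum_i `|tail_mx K i s| <= 2^-1.

Lemma near_small_tail : \forall K \near \oo, small_tail K.
Proof.
apply: filter_forall => s.
have : (fun K => \sum_i `|tail_mx K i s|) @ \oo --> \sum_(i < n) `|0 : R|.
  apply: cvg_big => [|i _]; first exact: add_continuous.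
  under eq_fun do rewrite mxE.
  exact: (cvg_norm (@cvg_pairing_tail R n (x s) i)).
by rewrite normr0 big1// => /cvgr_le; apply; rewrite invr_gt0.
Qed.

Lemma sum_tail_mx_le K s c (M : R) : small_tail K ->
  (forall i, `|c i| <= M) -> `|\sum_i c i * tail_mx K i s| <= M / 2.
Proof.
move=> tK cM; have M0 : 0 <= M by exact: le_trans (cM s).
apply: le_trans (ler_norm_sum _ _ _) _.
apply: (@le_trans _ _ (\sum_i M * `|tail_mx K i s|)).
  by apply: ler_sum => i _; rewrite normrM ler_wpM2r.
by rewrite -mulr_sumr ler_wpM2l.
Qed.

Lemma max_normP c s0 : exists s, forall i, `|c i| <= `|c s|.
Proof.
case: (@Order.TotalTheory.arg_maxP _ _ _ s0 xpredT (fun i => `|c i|)) => //.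
by move=> s _ cs; exists s => i; exact: cs.
Qed.

(** A row vector fixed by [tail_mx K] has its largest coordinate bounded by half of itself, hence
    vanishes. *)
Lemma small_tail_unit K : small_tail K -> 1%:M - tail_mx K \in unitmx.
Proof.
move=> tK; rewrite unitmxE unitfE; apply/det0P => -[d d0].
rewrite mulmxBr mulmx1 => /eqP; rewrite subr_eq0 => /eqP dE.
have [i0 di0] : exists i0, d 0 i0 != 0.
  apply/existsP; move: d0; apply: contraR; rewrite negb_exists => /forallP d0.
  by apply/eqP/rowP => i; rewrite mxE; apply/eqP; have := d0 i; rewrite negbK.
have [s sM] := max_normP (d 0) i0.
have : `|d 0 s| <= `|d 0 s| / 2.
  by rewrite {1}dE mxE sum_tail_mx_le.
have : 0 < `|d 0 i0| by rewrite normr_gt0.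
have := sM i0; lra.
Qed.

Definition defect g : 'rV[R]_n :=
  \row_s (pairing (x s) g - g (omega_lim_pt R s)).

(* The coefficients [d] with [d s - \sum_i d i * tail_mx K i s = defect g 0 s]:
   adding them to [g] far out in each row makes [g] satisfy the equations that
   define [W x]. *)
Definition correction K g : 'rV[R]_n := defect g *m invmx (1%:M - tail_mx K).

Definition W_proj_fun K g : COmega R n := g + omega_const K (correction K g 0).

Lemma pairing_const z K c :
  pairing z (omega_const K c) = \sum_i c i * pairing z (omega_tail R i K).
Proof. exact: (linear_omega_const (pairing z)). Qed.

Lemma W_proj_subproof K (tK : small_tail K) g : W_proj_fun K g \in W_pred x.
Proof.
apply/asboolP => s; rewrite COmegaDE omega_const_lim pairingDr pairing_const.
have := mulmxKV (small_tail_unit tK) (defect g).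
rewrite -/(correction K g) mulmxBr mulmx1 => /rowP/(_ s).
move: (correction K g) => d; rewrite !mxE.
under [X in _ - X = _]eq_bigr do rewrite mxE.
lra.
Qed.

Definition W_proj K (tK : small_tail K) g : W x := MkW (W_proj_subproof tK g).

Lemma defect_linear : linear defect.
Proof.
move=> a f g; apply/rowP => s; rewrite !mxE (linearP (pairing (x s))).
by rewrite COmegaDE COmegaZE /=; rewrite /GRing.scale/=; ring.
Qed.

Lemma omega_const_linear K (a : R) c c' :
  omega_const K (fun i => a * c i + c' i) =
  a *: omega_const K c + omega_const K c'.
Proof.
rewrite scaler_sumr -big_split/=; apply: eq_bigr => i _.
by rewrite scalerDl scalerA.
Qed.

Lemma W_proj_linear K (tK : small_tail K) : linear (W_proj tK).
Proof.
move=> a f g; apply/val_inj; rewrite /= /W_proj_fun.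
rewrite (_ : correction K _ 0 = fun i =>
  a * correction K f 0 i + correction K g 0 i); last first.
  apply/funext => i.
  by rewrite /correction defect_linear mulmxDl -scalemxAl !mxE.
by rewrite omega_const_linear scalerDr addrACA.
Qed.

Lemma W_proj_id K (tK : small_tail K) (f : W x) : W_proj tK f = f.
Proof.
apply/val_inj; rewrite /= /W_proj_fun /correction (_ : defect f = 0).
  rewrite mul0mx /omega_const big1 ?addr0// => i _.
  by rewrite mxE scale0r.
apply/rowP => s; rewrite !mxE.
by case: f => f /= /asboolP ->; rewrite subrr.
Qed.

Lemma W_proj_bounded K (tK : small_tail K) :
  exists C, forall g, `|W_proj tK g| <= C * `|g|.
Proof.
(* Coordinate [s] of the defect is at most [|x s| + 1] times the norm of [g]; the entries of the
   inverse matrix and the norms of the tails are bounded crudely. *)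
exists (1 + \sum_i (\sum_s (`|x s| + 1) * `|invmx (1%:M - tail_mx K) s i|) *
  `|omega_tail R i K|) => g.
rewrite mulrDl mul1r; apply: le_trans (ler_normD _ _) _; rewrite lerD2l.
rewrite mulr_suml; apply: le_trans (ler_norm_sum _ _ _) _.
apply: ler_sum => i _; rewrite normrZ mulrAC ler_wpM2r// mulr_suml mxE.
apply: le_trans (ler_norm_sum _ _ _) _.
apply: ler_sum => s _; rewrite normrM mulrAC ler_wpM2r// mxE.
rewrite mulrDl mul1r (le_trans (ler_normB _ _))// lerD ?le_COmega_norm//.
by rewrite mulrC pairing_le.
Qed.

(** The corrected [g] is a step function, so only the [d i] need bounding. As [g] vanishes at the
    limit points, [d s] is the pairing of [x s] with the corrected function. If the largest modulus
    [M] of the [d i] exceeded 1, [pairing_le] alone would only give [M <= M]; splitting [d] into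
    [d / M] and [(1 - M^-1) d] brings in the contraction. *)
Lemma W_proj_fin_norm_le1 K (hx : forall s, `|x s| <= 1)
    (tK : small_tail K) (v : 'I_n -> nat -> R) :
  (forall i j, `|v i j| <= 1) -> `|W_proj tK (omega_fin K v)| <= 1.
Proof.
move=> v1; set g := omega_fin K v; set d := correction K g 0.
have fW : W_proj_fun K g \in W_pred x := W_proj_subproof tK g.
suff d1 i : `|d i| <= 1 by apply: omega_step_norm_le.
have [s dM] := max_normP d i; apply: le_trans (dM i) _.
rewrite leNgt; apply/negP => M1; set M := `|d s| in dM M1.
have M0 : 0 < M by exact: lt_trans M1.
(* As [d / M] has norm at most 1, so does the first term; the second one is at
   most [(M - 1) / 2], which contradicts [1 < M]. *)
have dsE : d s = pairing (x s) (g + omega_const K (fun i => d i / M)) +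
    (1 - M^-1) * \sum_i d i * tail_mx K i s.
  have dsW : d s = pairing (x s) (g + omega_const K d).
    move/asboolP: fW => /(_ s).
    by rewrite COmegaDE omega_const_lim omega_fin_lim add0r.
  rewrite [LHS]dsW !pairingDr !pairing_const.
  rewrite /= -addrA; congr (_ + _); rewrite mulr_sumr -big_split/=.
  by apply: eq_bigr => k _; rewrite mxE; ring.
have p1 : `|pairing (x s) (g + omega_const K (fun i => d i / M))| <= 1.
  apply: le_trans (pairing_le _ _) _.
  apply: mulr_ile1 => //; apply: omega_step_norm_le => // k.
  by rewrite normrM normfV (ger0_norm (ltW M0)) ler_pdivrMr// mul1r.
have p2 : `|(1 - M^-1) * \sum_i d i * tail_mx K i s| <= (1 - M^-1) * (M / 2).
  have u0 : 0 <= 1 - M^-1 by rewrite subr_ge0 invf_le1// ltW.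
  by rewrite normrM (ger0_norm u0) ler_wpM2l// sum_tail_mx_le.
have : M <= 1 + (1 - M^-1) * (M / 2).
  by rewrite {1}/M dsE (le_trans (ler_normD _ _))// lerD.
rewrite (_ : (1 - M^-1) * (M / 2) = (M - 1) / 2); last by field; lra.
lra.
Qed.

End predual.

(** * The map [phi] is an isometry onto the dual *)

Lemma dual_le (R : realType) (V : normedModType R) (F : dual V) (v : V) :
  `|v| <= 1 -> `|F v| <= `|F|.
Proof. by move=> v1; exact: (le_sup_norm (dual_bounded F)). Qed.

Section duality_map.
Variables (R : realType) (n : nat) (x : 'I_n -> ell1 R ('I_n * nat)%type).
Implicit Types (f g : COmega R n) (z w : ell1 R ('I_n * nat)%type).

Lemma pairing_linearl f : linear (fun z => pairing z f).
Proof.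
move=> a z w; rewrite /pairing scaler_sumr -big_split/=; apply: eq_bigr => i _.
have cz := is_cvg_pairing_row (z := z) (f := f) (i := i).
have cw := is_cvg_pairing_row (z := w) (f := f) (i := i).
rewrite -[X in _ = X + _](lim_seriesZ a cz) -lim_seriesD//; last first.
  exact: (@is_cvg_seriesZ R _ a cz).
congr (limn (series _)); apply/funext => j.
by rewrite /= !fctE/= /GRing.scale/=; ring.
Qed.

Lemma phi_subproof z : (fun f : W x => pairing z f) \in @dual_pred R (W x).
Proof.
have lz : linear (fun f : W x => pairing z f).
  by move=> a f g; exact: (pairing_linearr z).
apply/asboolP; split => //.
pose L : {linear W x -> R} := HB.pack (fun f : W x => pairing z f)
  (GRing.isLinear.Build R (W x) R _ (fun f : W x => pairing z f) lz).
apply/(@linear_bounded_continuous _ _ _ L)/bounded_funP => r; exists (r * `|z|).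
by move=> f fr; rewrite (le_trans (pairing_le _ _))// ler_wpM2r.
Qed.

Definition phi z : dual (W x) := Dual (phi_subproof z).

Lemma phi_linear : linear phi.
Proof.
move=> a z w; apply/val_inj/funext => f.
exact: (pairing_linearl f a z w).
Qed.

Lemma phi_norm_le z : `|phi z| <= `|z|.
Proof.
apply: sup_norm_le => // f f1; apply: le_trans (pairing_le _ _) _.
by rewrite ler_piMl.
Qed.

Lemma phi_norm (hx : forall s, `|x s| <= 1) z : `|phi z| = `|z|.
Proof.
apply/eqP; rewrite eq_le phi_norm_le/=.
(* For every large [K] this sum will be a lower bound for the norm of [phi z], and its limit is the
   norm of [z]. *)
have : \sum_i (series (fun j => `|z (i, j)|) K -
      `|pairing z (omega_tail R i K)|) @[K --> \oo] -->
    \sum_i (limn (series (fun j => `|z (i, j)|)) - `|0 : R|).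
  apply: cvg_big => [|i _]; first exact: add_continuous.
  apply: cvgB; first exact: is_cvg_row.
  exact: (cvg_norm (@cvg_pairing_tail R n z i)).
under eq_bigr do rewrite normr0 subr0.
rewrite -ell1_normE => /cvgr_to_le; apply.
have [N _ tN] := near_small_tail x; exists N => // K /tN tK.
pose v i j := Num.sg (z (i, j)).
have v1 i j : `|v i j| <= 1 by rewrite normr_sg; case: eqP.
have f1 := W_proj_fin_norm_le1 hx tK v1.
apply: le_trans (dual_le (phi z) f1); apply: le_trans (ler_norm _).
set f := W_proj tK _ in f1 *.
have -> : phi z f = pairing z (omega_fin K v) +
    pairing z (omega_const K (correction x K (omega_fin K v) 0)).
  exact: pairingDr.
rewrite (linear_omega_fin (pairing z)) pairing_const -big_split/=.
apply: ler_sum => i _; apply: lerD.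
  rewrite /series/= big_mkord; apply: ler_sum => j _.
  by rewrite [pairing _ _]pairing_delta normrEsg.
(* The coefficient of the tail in row [i] is the value of [f] at a limit point, so it is at most 1
   in modulus. *)
rewrite lerNl (le_trans (ler_norm _))// normrN normrM ler_piMl//.
have := le_COmega_norm f (omega_lim_pt R i).
rewrite [X in `|X| <= _](_ : _ = correction x K (omega_fin K v) 0 i).
  by move=> h; exact: le_trans h f1.
rewrite -[LHS]/(W_proj_fun x K (omega_fin K v) (omega_lim_pt R i)).
by rewrite /W_proj_fun COmegaDE omega_fin_lim omega_const_lim add0r.
Qed.

Lemma phi_surj (F : dual (W x)) : exists z, phi z = F.
Proof.
have [N _ /(_ N (leqnn N)) tN] := near_small_tail x.
have [C PC] := W_proj_bounded tN.
have [B FB] : exists B, forall f : W x, `|F f| <= B * `|f|.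
  exists `|F| => f; have [->|f0] := eqVneq f 0.
    by rewrite linear0 !normr0 mulr0.
  rewrite -ler_pdivrMr ?normr_gt0// mulrC -(normr_id f) -normfV -normrM.
  rewrite -[_ * _]/(_ *: (F f : R^o)) -linearZ; apply: dual_le.
  by rewrite normrZ normfV normr_id mulVf// normr_eq0.
have lL : linear (fun g => F (W_proj tN g)).
  by move=> a f g; rewrite W_proj_linear linearP.
pose L : {linear COmega R n -> R} := HB.pack (fun g => F (W_proj tN g))
  (GRing.isLinear.Build R (COmega R n) R _ (fun g => F (W_proj tN g)) lL).
have LB g : `|L g| <= `|B| * C * `|g|.
  rewrite -mulrA (le_trans (FB _))//.
  rewrite (le_trans (ler_wpM2r (normr_ge0 _) (ler_norm B)))//.
  exact: ler_wpM2l.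
have [w [m Lwm]] := COmega_dual_repr LB.
(* On [W x], evaluation at the limit point of row [i] is the pairing with [x i], so the point masses
   [m i] become multiples of the [x i]. *)
exists (w + \sum_i m i *: x i); apply/val_inj/funext => f.
transitivity (L f); last by rewrite /= W_proj_id.
rewrite Lwm.
pose ev : {linear ell1 R ('I_n * nat)%type -> R} := HB.pack
  (fun z => pairing z f) (GRing.isLinear.Build R (ell1 R ('I_n * nat)%type) R _
    (fun z => pairing z f) (pairing_linearl f)).
rewrite [LHS](linearD ev) linear_sum; congr (_ + _); apply: eq_bigr => i _.
rewrite linearZ; congr (_ * _); rewrite -[LHS]/(pairing (x i) f).
by case: f @ev => f /= /asboolP ->.
Qed.

Lemma phi_isometry (hx : forall s, `|x s| <= 1) : linear_isometry_onto phi.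
Proof. split; [exact: phi_linear|exact: phi_norm|exact: phi_surj]. Qed.

End duality_map.

(** * Linear isometries and relabelling of [ell1] *)

Section isometries.
Variable R : realType.

Lemma linear_isometry_inj (V W : normedModType R) (T : V -> W) :
  linear T -> (forall v, `|T v| = `|v|) -> injective T.
Proof.
move=> lT nT u v Tuv; apply/eqP; rewrite -subr_eq0 -normr_eq0 -nT.
rewrite (_ : u - v = -1 *: v + u); last by rewrite scaleN1r addrC.
by rewrite lT Tuv scaleN1r addNr normr0.
Qed.

Lemma isometric_sym (V W : normedModType R) : isometric V W -> isometric W V.
Proof.
move=> [T [lT nT sT]]; have [S TS] := choice sT.
have T_inj := linear_isometry_inj lT nT.
exists S; split => [a u v|v|v].
- by apply: T_inj; rewrite lT !TS.
- by rewrite -nT TS.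
- by exists (T v); apply: T_inj; rewrite TS.
Qed.

Lemma isometric_trans (U V W : normedModType R) :
  isometric U V -> isometric V W -> isometric U W.
Proof.
move=> [S [lS nS sS]] [T [lT nT sT]]; exists (T \o S); split.
- by move=> a u v; rewrite /= lS lT.
- by move=> v; rewrite /= nT nS.
- by move=> w; have [v <-] := sT w; have [u <-] := sS v; exists u.
Qed.

Lemma ell1_reindex_esum (I J : choiceType) (h : I -> J) (z : J -> R) :
  bijective h -> \esum_(j in [set: J]) `|z j|%:E =
    \esum_(i in [set: I]) `|z (h i)|%:E.
Proof.
move=> bh; apply: (@reindex_esum R I J setT setT h (fun j => `|z j|%:E)).
by rewrite setTT_bijective.
Qed.

Lemma isometric_ell1 (I J : choiceType) (h : I -> J) : bijective h ->
  isometric (ell1 R J) (ell1 R I).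
Proof.
move=> bh.
(* Stated for all index types because it serves [h] and, for surjectivity, its inverse. *)
have sub (I' J' : choiceType) (k : I' -> J') (z : ell1 R J') : bijective k ->
    z \o k \in @ell1_pred R I'.
  move=> bk; apply/asboolP; rewrite /summable.
  rewrite -[esum _ _](ell1_reindex_esum z bk).
  by rewrite -EFin_ell1_norm ltry.
exists (fun z => Ell1 (sub _ _ h z bh)); split.
- by move=> a z w; exact/val_inj.
- move=> z; apply: EFin_inj; rewrite [LHS]EFin_ell1_norm [RHS]EFin_ell1_norm.
  by rewrite (ell1_reindex_esum z bh).
- move=> z; have [k hk kh] := bh.
  have bk : bijective k by exists h.
  exists (Ell1 (sub _ _ k z bk)); apply/val_inj/funext => i /=.
  by rewrite hk.
Qed.

End isometries.

(** Division by [n]: the remainder is the row and the quotient the column. This turns [ell1] over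
    ['I_n * nat] into the usual sequence space. *)
Lemma bijective_edivn (n : nat) : (0 < n)%N ->
  exists h : nat -> 'I_n * nat, bijective h.
Proof.
move=> n0; exists (fun k => (Ordinal (ltn_pmod k n0), k %/ n)%N).
exists (fun ij : 'I_n * nat => ij.2 * n + ij.1)%N => [k|[i j]] /=.
  by rewrite -divn_eq.
congr pair; last by rewrite divnMDl// divn_small ?addn0.
by apply/val_inj; rewrite /= modnMDl modn_small.
Qed.

(** * Weak* convergence, separation and limit points *)

Section weak_star.
Variables (R : realType) (V : normedModType R) (E : choiceType).
Variable T : E -> dual V.

Lemma weak_star_cvg (u : nat -> E) (l : E) :
  (forall v, T (u j) v @[j --> \oo] --> T l v) ->
  (u j : weak_star_topology T) @[j --> \oo] --> (l : weak_star_topology T).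
Proof.
move=> ul A [_ [[B oB <-] Bl BA]].
have Tul : (dual_val (T (u j)) : {ptws V -> R}) @[j --> \oo] -->
    (dual_val (T l) : {ptws V -> R}).
  by apply/pointwise_cvgP.
have := Tul B (open_nbhs_nbhs (conj oB Bl)).
by rewrite !nbhs_simpl/=; apply: filterS => j Bj; exact: BA.
Qed.

Lemma weak_star_eval_continuous (v : V) :
  continuous (fun z : weak_star_topology T => T z v).
Proof.
move=> z.
have c1 : {for z, continuous
    (fun z : weak_star_topology T => dual_val (T z) : {ptws V -> R})}.
  exact: initial_continuous.
exact: (cvg_comp _ _ c1 (@proj_continuous V (fun=> R) v _)).
Qed.

(** If all neighbourhoods of [p] and [q] meet, the values [T p v] and [T q v] cannot be separated in
    [R], so they agree for every [v]. *)
Lemma weak_star_hausdorff :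
  injective T -> hausdorff_space (weak_star_topology T).
Proof.
move=> iT p q pq; apply: iT; apply/val_inj/funext => v.
apply: (@Rhausdorff R) => A B /(weak_star_eval_continuous (v := v)) pA.
move=> /(weak_star_eval_continuous (v := v)) qB.
by have [r [Ar Br]] := pq _ _ pA qB; exists (T r v).
Qed.

End weak_star.

(** A point [t] outside [range x] can be separated from each of the finitely many [x s], so some
    neighbourhood of it misses a tail of every row. The finitely many terms of [e] left over are
    then removed. *)
Lemma limit_point_range_cvg (X : topologicalType) (I : finType)
    (e : I * nat -> X) (x : I -> X) :
  hausdorff_space X -> injective e ->
  (forall s, e (s, j) @[j --> \oo] --> x s) ->
  limit_point (range e) = range x.
Proof.
move=> hX ie ex; apply/seteqP; split=> [t tlim|_ [s _ <-] U Ux]; last first.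
  have [N _ NU] := ex s U Ux.
  (* By injectivity at most one term of the row equals [x s], so column [N] or [N.+1] supplies a
     point different from it. *)
  have [eN|eN] := eqVneq (e (s, N)) (x s).
    exists (e (s, N.+1)); split; [|by exists (s, N.+1)|exact: NU (leqnSn N)].
    by rewrite -eN; apply/eqP => /ie[] /eqP; rewrite gtn_eqF.
  by exists (e (s, N)); split; [|exists (s, N)|exact: NU (leqnn N)].
apply: contrapT => xt.
have /choice[A tA] s : exists A : set X, nbhs t A /\
    \forall j \near \oo, ~ A (e (s, j)).
  have ts : t != x s by apply: contra_notN xt => /eqP ->; exists s.
  have := hX; rewrite open_hausdorff => /(_ _ _ ts).
  move=> [[A B] /= [tA xB] [oA oB AB]].
  exists A; split; first by apply: open_nbhs_nbhs; split => //; exact: set_mem.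
  have : nbhs (x s) B by apply: open_nbhs_nbhs; split => //; exact: set_mem.
  move=> /(ex s); rewrite nbhs_simpl/=; apply: filterS => j Bj Aj.
  by move/eqP : AB; rewrite -subset0; apply; split; [exact: Aj|exact: Bj].
have [N _ NA] : \forall N \near \oo, forall s j, (N <= j)%N -> ~ A s (e (s, j)).
  apply: filter_forall => s; have [_ [N _ NA]] := tA s.
  by exists N => // M /= NM j Mj; apply: NA; exact: leq_trans Mj.
(* [t] may itself be a term of [e]; it is left out of [D] so that the complement of [D] is a
   neighbourhood of [t]. *)
pose D := [set e ij | ij in [set ij : I * nat | (ij.2 < N)%N]] `\ t.
have cD : closed D.
  apply: (accessible_finite_set_closed.1 (hausdorff_accessible hX)).
  apply/finite_setD/finite_image.
  rewrite (_ : [set _ | _] = [set: I] `*` `I_N).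
    by apply: finite_setX; [exact: finite_finset|exact: finite_II].
  by apply/seteqP; split => [[i j]//|[i j] []].
have tU : nbhs t ((\bigcap_(s in [set: I]) A s) `&` ~` D).
  apply: filterI.
    have : \forall y \near t, forall s, A s y.
      by apply: filter_forall => s; exact: (tA s).1.
    by apply: filterS => y yA s _; exact: yA.
  apply: open_nbhs_nbhs; split; first exact: closed_openC.
  by move=> -[_ /(_ erefl)].
have [y [yt [[s j] _ ey] [yA yD]]] := tlim _ tU; subst y.
have [jN|Nj] := ltnP j N; last exact: (NA _ (leqnn N) s j Nj (yA s Logic.I)).
by apply: yD; split; [exists (s, j)|exact/eqP].
Qed.

(** * The standard basis and the theorem *)

Lemma ell1_basis_inj (R : realType) (I : choiceType) :
  injective (@ell1_basis R I).
Proof.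
move=> i j /(congr1 (fun z : ell1 R I => z i)).
rewrite /= /ell1_basis_fun eqxx; case: eqP => // _ /eqP.
by rewrite oner_eq0.
Qed.

Lemma pairing_ell1_basis (R : realType) (n : nat) (i : 'I_n) (j : nat)
    (f : COmega R n) : pairing (ell1_basis R (i, j)) f = f (omega_pt R i j).
Proof.
rewrite /pairing (bigD1 i)//= [X in _ + X]big1 ?addr0 => [|i' i'i]; last first.
  rewrite (@lim_series_eventually0 _ _ 0) ?big_ord0// => j' _.
  by rewrite /ell1_basis_fun xpair_eqE (negbTE i'i) mulr0.
rewrite (@lim_series_eventually0 _ _ j.+1) => [|j' jj'].
  rewrite big_ord_recr/= /ell1_basis_fun.
  rewrite big1 => [|j' _]; rewrite xpair_eqE eqxx.
    by rewrite eqxx mulr1 add0r.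
  by rewrite ltn_eqF ?mulr0.
by rewrite /ell1_basis_fun xpair_eqE gtn_eqF// andbF mulr0.
Qed.

Theorem theorem2p1 (R : realType) (n : nat) (hn : (1 <= n)%N)
    (x : 'I_n -> ell1 R ('I_n * nat)%type) (hx : forall s, `|x s| <= 1) :
  isometric (dual (W x)) (ell1 R nat) /\
  exists phi : ell1 R ('I_n * nat)%type -> dual (W x),
    [/\ forall z (f : W x), phi z f =
          \sum_(i < n) limn (series (fun j => f (omega_pt R i j) * z (i, j))),
        linear_isometry_onto phi,
        limit_point (range (ell1_basis R) : set (weak_star_topology phi)) =
          range x &
        forall s, (ell1_basis R (s, j) : weak_star_topology phi) @[j --> \oo]
          --> (x s : weak_star_topology phi)].
Proof.
have phiI := phi_isometry hx.
split.
  have [h bh] := bijective_edivn hn.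
  apply: isometric_trans (isometric_ell1 R bh).
  by apply: isometric_sym; exists (phi x).
have ex s : (ell1_basis R (s, j) : weak_star_topology (phi x)) @[j --> \oo]
    --> (x s : weak_star_topology (phi x)).
  apply: weak_star_cvg => f.
  under eq_fun do rewrite [phi x _ f]pairing_ell1_basis.
  (* Membership of [f] in [W x] turns the claimed limit into the value at the limit point, so
     continuity of [f] finishes. *)
  rewrite (_ : phi x (x s) f = f (omega_lim_pt R s)); last first.
    by case: f => f /= /asboolP ->.
  exact: (cvg_comp _ _ (@cvg_omega_pt R n s)
    (@COmega_continuous _ _ (W_val f) _)).
exists (phi x); split => //.
apply: limit_point_range_cvg => //; last exact: ell1_basis_inj.
apply: weak_star_hausdorff.
exact: linear_isometry_inj (@phi_linear _ _ _) (phi_norm hx).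
Qed.
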